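(* Let $S$ be a finite semigroup with principal series $S=S_1\supset S_2\supset\cdots\supset S_o\supset S_{o+1}=\emptyset$. Suppose that $S_p/S_{p+1}$ ($1\le p\le o$) is a non-null principal factor of $S$ and that there is an element $a\in S_p\setminus S_{p+1}$ such that $a$ is not $\eta^{*}$-related to $\theta$. Then there exists an integer $p'$ with $p\le p'\le o$ such that the principal factor $S_{p'}/S_{p'+1}$ satisfies the following properties: (1) For every $x\in S_p\setminus S_{p+1}$ there exists $y\in S_{p'}\setminus S_{p'+1}$ such that $x\,\eta^{*}\,y$. (2) For every $z\in (S_p\setminus S_{p+1})\cup(S_{p'}\setminus S_{p'+1})$ and every $z'\in S_{p'+1}$, $z$ is not $\eta^{*}$-related to $z'$. (3) The principal factor $S_{p'}/S_{p'+1}$ is a CS-diagonal regular Rees matrix semigroup. (4) Identify $S_p\setminus S_{p+1}$ with the set of nonzero elements of a regular Rees matrix semigroup with group $G$, sizes $n,m$ and sandwich matrix $P=(p_{ji})$, and $S_{p'}\setminus S_{p'+1}$ with the set of nonzero elements of a regular Rees matrix semigroup with group $H$, sizes $n',m'$ and sandwich matrix $Q$. If $(g;\alpha,\beta),(g';\gamma,\lambda)\in S_p\setminus S_{p+1}$ are such that $p_{\beta,\gamma}\ne\theta$, and $(h;i,j),(h';k,l)\in S_{p'}\setminus S_{p'+1}$ are such that $(g;\alpha,\beta)\,\eta^{*}\,(h;i,j)$ and $(g';\gamma,\lambda)\,\eta^{*}\,(h';k,l)$, then $k\in\mathbb{I}_r$ and $j\in\mathbb{I}'_r$ for some $1\le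 r\le n'_{\eta^{*}}$, where $\mathbb{I}_r,\mathbb{I}'_r$ ($1\le r\le n'_{\eta^*}$) are the classes associated with $S_{p'}/S_{p'+1}$ (that is, with $Q$).
   Context: For a semigroup $S$, $S^1$ denotes $S$ if $S$ has an identity, and $S$ with an identity $1$ adjoined otherwise. For $x,y,z_1,z_2,\ldots$ in $S^1$ define recursively $\lambda_0=x$, $\rho_0=y$, and $\lambda_{n+1}=\lambda_n z_{n+1}\rho_n$, $\rho_{n+1}=\rho_n z_{n+1}\lambda_n$, where $\lambda_n=\lambda_n(x,y,z_1,\ldots,z_n)$ and $\rho_n=\rho_n(x,y,z_1,\ldots,z_n)$. For a semigroup $S$ let $\eta_1=\{(x,x)\mid x\in S\}$ and, for every integer $n>1$, let $x\,\eta_n\,y$ if and only if there exist $z_1,\ldots,z_n\in S^1$ such that $x=\lambda_n(x,y,z_1,\ldots,z_n)$ and $y=\rho_n(x,y,z_1,\ldots,z_n)$. Let $\eta$ be the transitive closure of $\bigcup_{i\ge 1}\eta_i$, and let $\eta^{*}$ be the smallest congruence on $S$ containing $\eta$. In the claim $\eta^*$ is taken on $S$. Principal series: each $S_p$ is an ideal of $S$ and there is no ideal of $S$ strictly between $S_p$ and $S_{p+1}$ (the empty set counts as an ideal, and $S_o/\emptyset=S_o$). Each principal factor $S_p/S_{p+1}$ is completely $0$-simple, completely simple, or null (all products equal zero; in particular a factor $\{\theta\}$ is null). The zero of $S$, if it exists, is denoted $\theta$; if $S$ has no zero, ''not $\eta^*$-related to $\theta$'' holds for every element. Rees matrix semigroups: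 $G$ is a finite group, $P=(p_{ji})$ is an $m\times n$ matrix with entries in $G\cup\{\theta\}$. The nonzero elements of $\mathcal{M}^0(G,n,m;P)$ are the triples $(g;i,j)$ with $g\in G$, $1\le i\le n$, $1\le j\le m$; the zero is $\theta$; the product is $(g;i,j)(h;k,l)=(g p_{jk} h;i,l)$ if $p_{jk}\ne\theta$ and $\theta$ otherwise. It is regular if every row and every column of $P$ contains a nonzero entry. If all entries of $P$ are nonzero, the set $\mathcal{M}(G,n,m;P)$ of nonzero elements is itself a semigroup. Finite completely $0$-simple semigroups are exactly (up to isomorphism) the finite regular $\mathcal{M}^0(G,n,m;P)$, and finite completely simple ones are the $\mathcal{M}(G,n,m;P)$ with $P$ having no zero entries. A finite regular Rees matrix semigroup with sandwich matrix $P$ is CS-diagonal if for all $1\le r,r'\le m$, $1\le t,t'\le n$: whenever $p_{r,t},p_{r',t},p_{r,t'}$ are nonzero, $p_{r',t'}$ is nonzero (so every completely simple one is CS-diagonal). In that case the relation ''$i_\alpha,i_\beta\in\{1,\ldots,n\}$ are equivalent iff there is $1\le j\le m$ with $p_{j,i_\alpha}$ and $p_{j,i_\beta}$ nonzero'' is an equivalence relation; its number of classes is denoted $n_{\eta^{*}}$ (and $n'_{\eta^*}$ when the size is $n'$), its classes $\mathbb{I}_1,\ldots,\mathbb{I}_{n_{\eta^{*}}}$, and $\mathbb{I}'_l=\{j : p_{j,i}\neq\theta \text{ for some } i\in\mathbb{I}_l\}$. The sets $\mathbb{I}'_l$ partition $\{1,\ldots,m\}$, and for $i\in\mathbb{I}_g$,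 $j\in\mathbb{I}'_h$ one has $p_{j,i}\ne\theta$ if and only if $g=h$. *)

(* Defs.v *)
From Stdlib Require Export Relation_Operators.
From mathcomp Require Export all_boot all_fingroup.
From mathcomp Require Export matrix.

Set Implicit Arguments.
Unset Strict Implicit.
Unset Printing Implicit Defensive.

(* A finite semigroup is given by a finType S and an associative operation mul
   (HB does not accept a join of Semigroup and Finite declared after the
   finStarMonoidType of fingroup). *)
Section Semigroups.

Variables (S : finType) (mul : S -> S -> S).
Local Notation "x ** y" := (mul x y) (at level 40, left associativity).

Definition is_identity (e : S) : Prop := forall x, e ** x = x /\ x ** e = x.

Definition is_zero (t : S) : Prop := forall x, t ** x = t /\ x ** t = t.

(* The product of S with an identity None adjoined; S^1 consists of the
   elements Some x, together with None only if S has no identity. *)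
Definition mul1 (x y : option S) : option S :=
  match x, y with
  | Some a, Some b => Some (a ** b)
  | Some _, None => x
  | None, _ => y
  end.

Definition in_S1 (x : option S) : Prop :=
  x = None -> ~ exists e, is_identity e.

(* The pair (lambda_n, rho_n)(x, y, z_1, ..., z_n), with z = [z_1, ..., z_n]. *)
Definition lambda_rho (x y : option S) (z : seq (option S)) :
    option S * option S :=
  foldl (fun lr c => (mul1 (mul1 lr.1 c) lr.2, mul1 (mul1 lr.2 c) lr.1))
        (x, y) z.

(* eta_n for n >= 1; the value at n = 0 is junk, never used below. *)
Definition eta_n (n : nat) (x y : S) : Prop :=
  if n <= 1 then x = y else
  exists z : n.-tuple (option S),
    [/\ forall i, in_S1 (tnth z i),
        Some x = (lambda_rho (Some x) (Some y) z).1
      & Some y = (lambda_rho (Some x) (Some y) z).2].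

Definition eta : S -> S -> Prop :=
  clos_trans S (fun x y => exists2 n, 1 <= n & eta_n n x y).

Definition congruence (C : S -> S -> Prop) : Prop :=
  [/\ forall x, C x x,
      forall x y, C x y -> C y x,
      forall x y z, C x y -> C y z -> C x z
    & forall x y c, C x y -> C (c ** x) (c ** y) /\ C (x ** c) (y ** c)].

Definition eta_star (x y : S) : Prop :=
  forall C : S -> S -> Prop,
    congruence C -> (forall a b, eta a b -> C a b) -> C x y.

(* The empty set is an ideal. *)
Definition ideal (A : {set S}) : Prop :=
  forall a x, a \in A -> x ** a \in A /\ a ** x \in A.

(* S = Sr 1 > Sr 2 > ... > Sr o > Sr o.+1 = empty set; the values of Sr at
   other indices are irrelevant. *)
Definition principal_series (o : nat) (Sr : nat -> {set S}) : Prop :=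
  [/\ Sr 1 = [set: S],
      Sr o.+1 = set0,
      forall p, 1 <= p <= o.+1 -> ideal (Sr p)
    & forall p, 1 <= p <= o ->
        Sr p.+1 \proper Sr p /\
        forall A, ideal A -> ~ (Sr p.+1 \proper A /\ A \proper Sr p)].

(* The quotient A / B identifies the elements of A with each other exactly when
   they are rees_eq B; for B empty this is A itself. *)
Definition rees_eq (B : {set S}) (x y : S) : Prop :=
  x = y \/ x \in B /\ y \in B.

(* All products in A / B equal one element, which is then the zero of A / B. *)
Definition null_factor (A B : {set S}) : Prop :=
  exists2 t, t \in A & forall x y, x \in A -> y \in A -> rees_eq B (x ** y) t.

End Semigroups.

Section ReesMatrix.

Variables (G : finGroupType) (n m : nat) (P : 'M[option G]_(m, n)).

(* The zero theta, of P and of the Rees matrix semigroup, is None; the triple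
   (g; i, j) is Some (g, i, j). *)
Definition rees_mul (x y : option (G * 'I_n * 'I_m)) :
    option (G * 'I_n * 'I_m) :=
  match x, y with
  | Some (g, i, j), Some (h, k, l) =>
      if P j k is Some q then Some ((g * q * h)%g, i, l) else None
  | _, _ => None
  end.

Definition rees_regular : Prop :=
  (forall j, exists i, P j i <> None) /\ (forall i, exists j, P j i <> None).

Definition CS_diagonal : Prop :=
  forall r r' t t',
    P r t <> None -> P r' t <> None -> P r t' <> None -> P r' t' <> None.

Definition col_equiv : rel 'I_n :=
  fun i1 i2 => [exists j, (P j i1 != None) && (P j i2 != None)].

Definition col_classes : {set {set 'I_n}} :=
  equivalence_partition col_equiv [set: 'I_n].

Definition n_eta_star : nat := #|col_classes|.

Definition I_class (r : 'I_n_eta_star) : {set 'I_n} := enum_val r.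

Definition I'_class (r : 'I_n_eta_star) : {set 'I_m} :=
  [set j | [exists i in I_class r, P j i != None]].

(* phi identifies the nonzero elements of M^0(G, n, m; P) with A \ B so that
   A / B becomes M^0(G, n, m; P) if B is a nonempty ideal, and M(G, n, m; P) if
   B is empty (the last clause then forces all the entries of P to be nonzero). *)
Definition rees_identification (S : finType) (mul : S -> S -> S)
    (A B : {set S}) (phi : G * 'I_n * 'I_m -> S) : Prop :=
  [/\ injective phi,
      forall x, x \in A :\: B <-> exists u, phi u = x
    & forall u v,
        if rees_mul (Some u) (Some v) is Some w
        then mul (phi u) (phi v) = phi w
        else mul (phi u) (phi v) \in B].

End ReesMatrix.

(* Main.v *)
(* Let J_q = S_q \ S_(q+1). Among the terms from S_p on, let S_p' be the last
   one containing an element eta*-related to a. Multiplying on both sides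
   transports the relation over the whole of J_p and J_p', giving (1) and (2).
   J_p is not null, hence contains an idempotent; an element of J_p' related
   to it has its square in J_p', so J_p' contains an idempotent too, and Rees'
   theorem gives coordinates. R-related and L-related idempotents are
   eta-related, so a zero entry opposite three nonzero ones would relate an
   idempotent to an element of S_(p'+1), against (2); the same applies to (4),
   where a zero entry would send a product of J_p into S_(p'+1). *)
From HB Require Import structures.
From Stdlib Require Import Classical_Prop.
Require Import Defs.

Set Implicit Arguments.
Unset Strict Implicit.
Unset Printing Implicit Defensive.

(** * Finite semigroups: idempotents and subgroups *)

Section Semigroup.

Variables (S : finType) (mul : S -> S -> S).
Hypothesis mulA : associative mul.
Local Notation "x ** y" := (mul x y) (at level 40, left associativity).
Local Notation m1 := (mul1 mul).

Lemma mul1A : associative m1.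
Proof. by move=> [x|] [y|] [z|] //=; rewrite mulA. Qed.

Lemma ideal_mul1 (I : {set S}) u v x y :
  ideal mul I -> x \in I -> Some y = m1 (m1 u (Some x)) v -> y \in I.
Proof.
move=> idI xI.
have l z w : z \in I -> w ** z \in I by move=> zI; case: (idI z w zI).
have r z w : z \in I -> z ** w \in I by move=> zI; case: (idI z w zI).
by case: u v => [u|] [v|] /= [->]; auto.
Qed.

(** Strong induction on the size of [T]: for [a] in [T], either [a T] or the set of [x] with
    [a ** x = a] is a smaller nonempty subsemigroup, or both equal [T], and then [a ** a = a]. *)
Lemma exists_idempotent (T : {set S}) :
  T != set0 -> {in T &, forall x y, x ** y \in T} ->
  exists2 e, e \in T & e ** e = e.
Proof.
have [n] := ubnP #|T|; elim: n T => // n IHn T leTn /set0Pn[a aT] TM.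
have step (U : {set S}) : U \proper T -> U != set0 ->
    {in U &, forall x y, x ** y \in U} -> exists2 e, e \in T & e ** e = e.
  move=> prU U0 UM; have [|e eU ee] := IHn U _ U0 UM.
    exact: leq_trans (proper_card prU) _.
  by exists e => //; apply: (subsetP (proper_sub prU)).
pose aT' := [set a ** x | x in T].
have saT : aT' \subset T by apply/subsetP => _ /imsetP[x xT ->]; apply: TM.
have [eaT|neaT] := eqVneq aT' T; last first.
  apply: (step aT'); first by rewrite properEneq neaT.
    by apply/set0Pn; exists (a ** a); apply: imset_f.
  move=> _ _ /imsetP[x xT ->] /imsetP[y yT ->].
  by rewrite -mulA; apply: imset_f; rewrite TM // TM.
have /imsetP[b bT ab] : a \in aT' by rewrite eaT.
pose U := [set x in T | a ** x == a].
have sUT : U \subset T by apply/subsetP => x; rewrite inE => /andP[].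
have [eU|neU] := eqVneq U T; last first.
  apply: (step U); first by rewrite properEneq neU.
    by apply/set0Pn; exists b; rewrite inE bT -ab eqxx.
  move=> x y; rewrite !inE => /andP[xT /eqP ax] /andP[yT /eqP ay].
  by rewrite TM //= mulA ax ay.
by exists a => //; move: aT; rewrite -{1}eU inE => /andP[_ /eqP].
Qed.

(** A left identity and left inverses already make [D] a group. This supplies the structure group of
    the Rees coordinates. *)
Lemma finGroup_of_set (D : {set S}) (e : S) :
  {in D &, forall x y, x ** y \in D} -> e \in D ->
  {in D, forall x, e ** x = x} ->
  {in D, forall x, exists2 y, y \in D & y ** x = e} ->
  exists (H : finGroupType) (f : H -> S),
    [/\ injective f, forall x, x \in D <-> exists h, f h = x
      & {morph f : x y / (x * y)%g >-> x ** y}].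
Proof.
move=> DM eD e1 DV.
pose T := {x : S | x \in D}.
pose mulT (x y : T) : T := exist _ (val x ** val y) (DM _ _ (valP x) (valP y)).
pose oneT : T := exist _ e eD.
(* The default is never reached, since [DV] gives a left inverse. *)
pose invT (x : T) : T := odflt x [pick y : T | val y ** val x == e].
have mulTA : associative mulT by move=> x y z; apply: val_inj; rewrite /= mulA.
have mul1T : left_id oneT mulT by move=> x; apply: val_inj; apply: e1 (valP x).
have mulVT : left_inverse oneT invT mulT.
  move=> x; apply: val_inj; rewrite /invT /=; case: pickP => [y /eqP //|no].
  have [y yD yx] := DV _ (valP x).
  by have := no (exist _ y yD); rewrite /= yx eqxx.
pose isG := Finite_isGroup.Build T mulTA mul1T mulVT.
pose H : finGroupType := HB.pack T isG.
exists H, (fun h : H => val (h : T)); split=> //.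
- exact: val_inj.
- move=> x; split=> [xD|[h <-]]; last exact: (valP (h : T)).
  by exists (exist _ x xD : T).
Qed.

(** * Principal factors: divisibility, stability, idempotents *)

Definition principal_factor (A B : {set S}) : Prop :=
  [/\ ideal mul A, ideal mul B, B \proper A
    & forall C, ideal mul C -> ~ (B \proper C /\ C \proper A)].

Section Factor.

Variables A B : {set S}.
Hypothesis AB : principal_factor A B.
Let J := A :\: B.

Let idA : ideal mul A. Proof. by case: AB. Qed.
Let idB : ideal mul B. Proof. by case: AB. Qed.

Lemma factorE x : (x \in J) = (x \in A) && (x \notin B).
Proof. by rewrite inE andbC. Qed.

(** The elements of [A] in [B] or in [S^1 a S^1] form an ideal strictly above [B], hence all of
    [A]. *)
Lemma factor_divides a b :
  a \in J -> b \in J -> exists u v, Some b = m1 (m1 u (Some a)) v.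
Proof.
rewrite !factorE => /andP[aA aB] /andP[bA bB].
have [_ _ prBA noC] := AB.
pose C := [set x in A | (x \in B) ||
  [exists u, exists v, Some x == m1 (m1 u (Some a)) v]].
have idC : ideal mul C.
  move=> c x; rewrite !inE => /andP[cA].
  have [-> ->] := @idA c x cA.
  case/orP => [cB|]; first by have [-> ->] := @idB c x cB.
  move=> /existsP[u /existsP[v /eqP cE]].
  split; apply/orP; right; apply/existsP.
    exists (m1 (Some x) u); apply/existsP; exists v; apply/eqP.
    by rewrite -!mul1A (mul1A u) -cE.
  exists u; apply/existsP; exists (m1 v (Some x)); apply/eqP.
  by rewrite mul1A -cE.
have BC : B \proper C.
  apply/properP; split.
    apply/subsetP => x xB.
    by rewrite !inE xB (subsetP (proper_sub prBA)).
  exists a => //; rewrite !inE aA; apply/orP; right.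
  by apply/existsP; exists None; apply/existsP; exists None.
have sCA : C \subset A by apply/subsetP => x; rewrite inE => /andP[].
have eCA : C = A.
  apply/eqP; apply: contraT => neCA.
  by case: (noC C idC); split=> //; rewrite properEneq neCA.
move: bA; rewrite -eCA !inE (negPf bB) /= => /andP[_].
by move=> /existsP[u /existsP[v /eqP bE]]; exists u, v.
Qed.

Lemma factor_mull x y : x ** y \in J -> y \in A -> y \in J.
Proof.
rewrite !factorE => /andP[_ xyB] ->; apply: contra xyB => yB.
by case: (@idB _ x yB).
Qed.

Lemma factor_mulr x y : x ** y \in J -> x \in A -> x \in J.
Proof.
rewrite !factorE => /andP[_ xyB] ->; apply: contra xyB => xB.
by case: (@idB _ y xB).
Qed.

Lemma ideal_mull x y : y \in A -> x ** y \in A.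
Proof. by case/(@idA _ x). Qed.

Lemma ideal_mulr x y : x \in A -> x ** y \in A.
Proof. by case/(@idA _ y). Qed.

(* The w in W with a in S^1 a w form a subsemigroup; an idempotent w among them
   satisfies a w = a. *)
Lemma idempotent_right_unit (W : {set S}) a u w :
  {in W &, forall x y, x ** y \in W} -> w \in W ->
  Some a = m1 (m1 u (Some a)) (Some w) ->
  exists2 f, f \in W & f ** f = f /\ a ** f = a.
Proof.
move=> WM wW aE.
pose T := [set x in W | [exists u, Some a == m1 (m1 u (Some a)) (Some x)]].
have [||f] := @exists_idempotent T.
- by apply/set0Pn; exists w; rewrite inE wW; apply/existsP; exists u; apply/eqP.
- move=> x y; rewrite !inE => /andP[xW /existsP[s /eqP sE]].
  move=> /andP[yW /existsP[t /eqP tE]]; rewrite WM //=.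
  apply/existsP; exists (m1 t s); apply/eqP.
  rewrite [LHS]tE {1}sE.
  by change (Some (x ** y)) with (m1 (Some x) (Some y)); rewrite !mul1A.
- rewrite inE => /andP[fW /existsP[s /eqP sE]] ff; exists f => //; split=> //.
  have: m1 (Some a) (Some f) = Some a.
    by rewrite {1}sE -mul1A /= ff -sE.
  by case.
Qed.

(** Stability of finite semigroups: from [a = u a x v], some idempotent of [x S^1] fixes [a] on the
    right, and it is [x] or a right multiple of [x]. *)
Lemma right_stable a x :
  a \in J -> a ** x \in J -> exists y, a ** x ** y = a.
Proof.
move=> aJ axJ; have [u [v aE]] := factor_divides axJ aJ.
pose W := x |: [set x ** y | y in [set: S]].
have WP w : (w \in W) -> exists y, a ** w = a -> a ** x ** y = a.
  rewrite 2!inE => /orP[/eqP ->|/imsetP[y _ ->]].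
    by exists x => ax; rewrite ax.
  by exists y; rewrite mulA.
have xyW y : x ** y \in W by rewrite !inE imset_f ?orbT.
have xW : x \in W by rewrite !inE eqxx.
have WM : {in W &, forall w z, w ** z \in W}.
  move=> w z; rewrite 2!inE => /orP[/eqP ->|/imsetP[y _ ->]] _ //.
  by rewrite -mulA.
pose w := if v is Some v' then x ** v' else x.
have wW : w \in W by rewrite /w; case: (v).
have [|f /WP[y yE] [_ /yE]] := @idempotent_right_unit W a u w WM wW.
  by rewrite [LHS]aE /w; case: (v) => [v'|]; case: (u) => [u'|] /=;
    rewrite ?mulA.
by exists y.
Qed.

(** Writing [x = u x y v] gives an idempotent [f] of [A] with [x ** f = x]; it avoids [B] because
    [x] does. *)
Lemma factor_idempotent x y :
  x \in J -> y \in J -> x ** y \in J -> exists2 e, e \in J & e ** e = e.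
Proof.
move=> xJ yJ xyJ; have [u [v xE]] := factor_divides xyJ xJ.
pose w := if v is Some v' then y ** v' else y.
have yA : y \in A by move: yJ; rewrite factorE => /andP[].
have wA : w \in A by rewrite /w; case: (v) => [v'|] //; apply: ideal_mulr.
have [|||f fA [ff xf]] := @idempotent_right_unit A x u w.
- by move=> s t sA _; apply: ideal_mulr.
- exact: wA.
- by rewrite [LHS]xE /w; case: (v) => [v'|]; case: (u) => [u'|] /=;
    rewrite ?mulA.
- by exists f => //; apply: (@factor_mull x) => //; rewrite xf.
Qed.

End Factor.
End Semigroup.

(** * Left-right duality through the opposite multiplication *)

Definition op_mul (S : Type) (mul : S -> S -> S) : S -> S -> S :=
  fun x y => mul y x.

Section Opposite.

Variables (S : finType) (mul : S -> S -> S).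

Lemma op_mulA : associative mul -> associative (op_mul mul).
Proof. by move=> mulA x y z; rewrite /op_mul mulA. Qed.

Lemma op_ideal (I : {set S}) : ideal mul I <-> ideal (op_mul mul) I.
Proof. by split=> idI a x /(idI a x)[]. Qed.

Lemma op_factor (A B : {set S}) :
  principal_factor mul A B -> principal_factor (op_mul mul) A B.
Proof.
move=> [/op_ideal idA /op_ideal idB BA noC]; split=> // C /op_ideal.
exact: noC.
Qed.

Lemma left_stable (A B : {set S}) a x :
  associative mul -> principal_factor mul A B ->
  a \in A :\: B -> mul x a \in A :\: B -> exists y, mul y (mul x a) = a.
Proof.
by move=> mulA /op_factor AB; apply: (right_stable (op_mulA mulA) AB).
Qed.

End Opposite.

(* The L-class of the idempotent e within the factor A / B; over op_mul, this is
   its R-class. *)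
Definition L_set (S : finType) (mul : S -> S -> S) (A B : {set S}) (e : S) :=
  [set x in A :\: B | mul x e == x].

(** For an idempotent [e] of the factor, this is the maximal subgroup at [e]. *)
Definition H_set (S : finType) (mul : S -> S -> S) (A B : {set S}) (e : S) :=
  L_set mul A B e :&: L_set (op_mul mul) A B e.

Lemma H_set_op (S : finType) (mul : S -> S -> S) (A B : {set S}) (e : S) :
  H_set (op_mul mul) A B e = H_set mul A B e.
Proof. exact: setIC. Qed.

(** * Green's classes of an idempotent *)

Section LeftClass.

Variables (S : finType) (mul : S -> S -> S).
Hypothesis mulA : associative mul.
Variables A B : {set S}.
Hypothesis AB : principal_factor mul A B.
Variable e : S.
Hypotheses (eJ : e \in A :\: B) (ee : mul e e = e).
Local Notation "x ** y" := (mul x y) (at level 40, left associativity).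
Local Notation J := (A :\: B).
Local Notation L := (L_set mul A B e).
Local Notation R := (L_set (op_mul mul) A B e).
Local Notation H := (H_set mul A B e).

Lemma L_setP x : x \in L -> x \in J /\ x ** e = x.
Proof. by rewrite inE => /andP[? /eqP]. Qed.

(** Left stability applied to [x ** e = x] gives [y] with [y ** x = e]; then [e ** y] is also a left
    inverse and lies in [R]. *)
Lemma L_left_inverse x : x \in L -> exists2 y, y \in R & y ** x = e.
Proof.
move=> /L_setP[xJ xe]; have [|y yE] := left_stable (x := x) mulA AB eJ.
  by rewrite xe.
have eyx : e ** y ** x = e by move: yE; rewrite -mulA xe => ->.
exists (e ** y) => //; rewrite inE; apply/andP; split; last first.
  by apply/eqP; rewrite /op_mul mulA ee.
apply: (@factor_mulr _ mul _ _ AB _ x); first by rewrite eyx.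
by apply: (ideal_mulr AB); move: eJ; rewrite factorE => /andP[].
Qed.

Lemma H_setP x : reflect [/\ x \notin B, e ** x = x & x ** e = x] (x \in H).
Proof.
apply: (iffP idP) => [|[xB ex xe]].
  rewrite !inE => /andP[/andP[/andP[xB _] /eqP xe] /andP[_ /eqP ex]].
  by split.
have xA : x \in A.
  by rewrite -ex; apply: (ideal_mulr AB); move: eJ; rewrite factorE => /andP[].
by rewrite !inE xB xA /op_mul ex xe !eqxx.
Qed.

Lemma H_J x : x \in H -> x \in J.
Proof. by rewrite inE => /andP[/L_setP[]]. Qed.

Lemma H_left_unit x : x \in H -> e ** x = x.
Proof. by case/H_setP. Qed.

Lemma idempotent_in_H : e \in H.
Proof. by apply/H_setP; move: eJ; rewrite factorE => /andP[]. Qed.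

Lemma factor_middle u x v : u ** x ** v \in J -> x \notin B.
Proof.
rewrite factorE => /andP[_]; apply: contra => xB.
have [_ idB _ _] := AB.
by case: (@idB x u xB) => uxB _; case: (@idB _ v uxB).
Qed.

(** With left inverses [s] of [x] and [t] of [y], the product [t s x y] equals [e], which keeps
    [x ** y] out of [B]. *)
Lemma H_mul : {in H &, forall x y, x ** y \in H}.
Proof.
move=> x y xH yH; have /H_setP[_ ex xe] := xH; have /H_setP[_ ey ye] := yH.
have [s _ sx] := L_left_inverse (setIP xH).1.
have [t _ ty] := L_left_inverse (setIP yH).1.
apply/H_setP; split; rewrite ?mulA ?ex -?mulA ?ye //.
apply: (@factor_middle (t ** s) _ e).
by rewrite -mulA -mulA -(mulA x) ye (mulA s) sx ey ty.
Qed.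

(** A left inverse [s] in [R] may lie outside [L]; [s ** e] lies in both and still inverts [x],
    since [e ** x = x]. *)
Lemma H_left_inverse x : x \in H -> exists2 y, y \in H & y ** x = e.
Proof.
move=> xH; have /H_setP[_ ex xe] := xH.
have [s] := L_left_inverse (setIP xH).1.
rewrite inE => /andP[sJ /eqP es sx]; rewrite /op_mul in es.
have sex : s ** e ** x = e by rewrite -mulA ex.
exists (s ** e) => //; apply/H_setP; split; rewrite ?mulA ?es -?mulA ?ee //.
by apply: (@factor_middle e _ x); rewrite -mulA sex ee.
Qed.

Lemma H_inverse h : h \in H -> exists k, [/\ k \in H, k ** h = e & h ** k = e].
Proof.
move=> hH; have [k kH kh] := H_left_inverse hH.
have [k' k'H kk'] := H_left_inverse kH.
exists k; split=> //.
by rewrite -(H_left_unit hH) -kk' -(mulA k') kh -mulA (H_left_unit kH).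
Qed.

Lemma L_mul_H x h : x \in L -> h \in H -> x ** h \in L.
Proof.
move=> xL hH; have [xJ _] := L_setP xL; have /H_setP[_ eh he] := hH.
have [s _ sx] := L_left_inverse xL; rewrite inE -mulA he eqxx andbT factorE.
apply/andP; split.
  by apply: (ideal_mulr AB); move: xJ; rewrite factorE => /andP[].
apply: (@factor_middle s _ e); rewrite mulA sx eh he.
exact: H_J.
Qed.

(** [H] acts on [L] by right multiplication; [I] takes one point from each orbit. *)
Lemma L_transversal : exists I : {set S},
  [/\ I \subset L,
      forall x, x \in L -> exists r h, [/\ r \in I, h \in H & x = r ** h]
    & forall r r' h, r \in I -> r' \in I -> h \in H -> r' = r ** h -> r = r'].
Proof.
pose E x y := [exists h in H, y == x ** h].
have EP x y : reflect (exists2 h, h \in H & y = x ** h) (E x y).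
  apply: (iffP existsP) => [[h /andP[hH /eqP]]|[h hH ->]]; first by exists h.
  by exists h; rewrite hH eqxx.
have Erefl x : x \in L -> E x x.
  by move=> /L_setP[_ xe]; apply/EP; exists e; rewrite ?idempotent_in_H.
have Etrans y x z : E x y -> E y z -> E x z.
  move=> /EP[h hH ->] /EP[k kH ->]; apply/EP.
  by exists (h ** k); rewrite ?mulA ?H_mul.
have Esym x y : x \in L -> E x y -> E y x.
  move=> /L_setP[_ xe] /EP[h hH ->]; have [k [kH _ hk]] := H_inverse hH.
  by apply/EP; exists k; rewrite // -mulA hk.
(* [pick] sees only the predicate, which is the same along an orbit, so [f] is constant on
   orbits. *)
pose f x := odflt x [pick y in L | E x y].
have fP x : x \in L -> f x \in L /\ E x (f x).
  move=> xL; rewrite /f; case: pickP => [y /andP[]|/(_ x)] //=.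
  by rewrite xL Erefl.
have fE x y : x \in L -> y \in L -> E x y -> f x = f y.
  move=> xL yL xy; rewrite /f (@eq_pick _ _ (fun z => (z \in L) && E y z)).
    by case: pickP => // /(_ y); rewrite yL Erefl.
  move=> z; rewrite /=; case: (z \in L) => //=; apply/idP/idP.
    exact: Etrans (Esym _ _ xL xy).
  exact: Etrans.
exists [set f x | x in L]; split.
- by apply/subsetP => _ /imsetP[x xL ->]; case: (fP x xL).
- move=> x xL; have [fL /(Esym _ _ xL)/EP[h hH xE]] := fP x xL.
  by exists (f x), h; split=> //; apply: imset_f.
- move=> _ _ h /imsetP[x xL ->] /imsetP[y yL ->] hH fyE.
  have [fxL Exfx] := fP x xL; have [fyL Eyfy] := fP y yL.
  apply: fE => //; apply: (Etrans _ _ _ Exfx).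
  apply: (Etrans (f y)); last exact: Esym.
  by apply/EP; exists h.
Qed.

(** Here [x = u e v = (u e)(e v)], and neither factor lies in [B] since [x] does not. *)
Lemma factor_LR x : x \in J -> exists r l, [/\ r \in L, l \in R & x = r ** l].
Proof.
move=> xJ; have [u [v xE]] := factor_divides mulA AB eJ xJ.
have eA : e \in A by move: eJ; rewrite factorE => /andP[].
pose r := if u is Some u' then u' ** e else e.
pose l := if v is Some v' then e ** v' else e.
have rl : x = r ** l.
  move: xE; rewrite /r /l; case: (u) => [u'|]; case: (v) => [v'|] /= [->].
  - by rewrite mulA -(mulA u' e e) ee.
  - by rewrite -mulA ee.
  - by rewrite mulA ee.
  - by rewrite ee.
exists r, l; split=> //; rewrite inE.
  rewrite (@factor_mulr _ _ _ _ AB _ l) -?rl //=.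
    by rewrite /r; case: (u) => [u'|]; rewrite -?mulA ee.
  by rewrite /r; case: (u) => [u'|] //; apply: (ideal_mull AB).
rewrite (@factor_mull _ _ _ _ AB r) -?rl //=.
  by rewrite /op_mul /l; case: (v) => [v'|]; rewrite ?mulA ee.
by rewrite /l; case: (v) => [v'|] //; apply: (ideal_mulr AB).
Qed.

End LeftClass.

(** * Right inverses and Rees coordinates *)

Section RightInverses.

Variables (S : finType) (mul : S -> S -> S).
Hypothesis mulA : associative mul.
Variables A B : {set S}.
Hypothesis AB : principal_factor mul A B.
Variable e : S.
Hypotheses (eJ : e \in A :\: B) (ee : mul e e = e).
Local Notation "x ** y" := (mul x y) (at level 40, left associativity).
Local Notation J := (A :\: B).
Local Notation L := (L_set mul A B e).
Local Notation R := (L_set (op_mul mul) A B e).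
Local Notation H := (H_set mul A B e).

Let opA := op_mulA mulA.
Let opAB := op_factor AB.

Lemma R_right_inverse x : x \in R -> exists2 y, y \in L & x ** y = e.
Proof. exact: (L_left_inverse opA opAB eJ ee). Qed.

Lemma H_of_RL x y : x \in R -> y \in L -> x ** y \notin B -> x ** y \in H.
Proof.
move=> /L_setP[_]; rewrite /op_mul => ex /L_setP[_ ye] xyB.
by apply/(H_setP AB eJ); split; rewrite // ?mulA ?ex // -mulA ye.
Qed.

(** Cancelling [x] by a right inverse [t] and [h] by its inverse [k] leaves [r = r' (h' y t k)]. The
    bracket is fixed by [e] on both sides and avoids [B] because [r] does, so it lies in [H]. This
    yields the uniqueness of coordinates. *)
Lemma L_div_H r r' h h' x y :
  r \in L -> r' \in L -> h \in H -> h' \in H -> x \in R -> y \in R ->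
  r ** h ** x = r' ** h' ** y -> exists2 k, k \in H & r = r' ** k.
Proof.
move=> rL r'L hH h'H xR yR E.
have [t tL xt] := R_right_inverse xR.
have [k [kH kh hk]] := H_inverse mulA AB eJ ee hH.
have [/L_setP[_ re] /L_setP[_ r'e]] := (rL, r'L).
have /L_setP[_] := yR; rewrite /op_mul => ey.
have /L_setP[kJ ke] := (setIP kH).1.
have rE : r = r' ** (h' ** (y ** t) ** k).
  rewrite !mulA -E -(mulA _ x) xt.
  by rewrite -(mulA r) (L_setP (setIP hH).1).2 -mulA hk re.
exists (h' ** (y ** t) ** k) => //.
have /(H_setP AB eJ)[_ eh' _] := h'H.
apply/(H_setP AB eJ); split; last 2 first.
- by rewrite !mulA eh'.
- by rewrite -!mulA ke.
apply/negP => inB; have [rJ _] := L_setP rL; move: rJ; rewrite factorE.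
have [_ idB _ _] := AB.
by rewrite rE; have [-> _] := @idB _ r' inB; rewrite andbF.
Qed.

End RightInverses.

(* Each element of A \ B is uniquely r h l, with h in the maximal subgroup H at
   e, and r, l in transversals of the H-orbits on the L- and R-class of e; the
   sandwich matrix holds the products l r. *)
Theorem rees_theorem (S : finType) (mul : S -> S -> S) (mulA : associative mul)
    (A B : {set S}) (AB : principal_factor mul A B) (e : S) :
  e \in A :\: B -> mul e e = e ->
  exists (H : finGroupType) (n m : nat) (Q : 'M[option H]_(m, n))
         (psi : H * 'I_n * 'I_m -> S),
    rees_regular Q /\ rees_identification Q mul A B psi.
Proof.
move=> eJ ee; have opA := op_mulA mulA; have opAB := op_factor AB.
have [I [IL IT I1]] := L_transversal mulA AB eJ ee.
have [K [KR KT K1]] := L_transversal opA opAB eJ ee.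
(* The H-class is self-dual, so [K] is a transversal for left multiplication by the same
   subgroup. *)
rewrite H_set_op in KT K1; rewrite /op_mul in KT K1.
have [H [f [f_inj fP fM]]] := finGroup_of_set mulA (H_mul mulA AB eJ ee)
  (idempotent_in_H AB eJ ee) (H_left_unit AB eJ)
  (@H_left_inverse _ _ mulA _ _ AB _ eJ ee).
have fH h : f h \in H_set mul A B e by apply/fP; exists h.
pose r (i : 'I_#|I|) : S := enum_val i; pose l (j : 'I_#|K|) : S := enum_val j.
have rI i : r i \in I by apply: enum_valP.
have lK i : l i \in K by apply: enum_valP.
have rL i : r i \in L_set mul A B e by apply: (subsetP IL).
have lR j : l j \in L_set (op_mul mul) A B e by apply: (subsetP KR).
(* [pick] returns [None] exactly when the product lies in [B]: outside [B], a product from R times L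
   lies in the H-class of [e]. *)
pose Q := (\matrix_(j < #|K|, i < #|I|)
  [pick h : H | f h == mul (l j) (r i)])%R.
pose psi (u : H * 'I_#|I| * 'I_#|K|) := mul (mul (r u.1.2) (f u.1.1)) (l u.2).
have QP j i : if Q j i is Some q then f q = mul (l j) (r i)
              else mul (l j) (r i) \in B.
  rewrite mxE; case: pickP => [h /eqP //|no].
  apply: contraT => /(H_of_RL mulA AB eJ (lR j) (rL i)) /fP[h hE].
  by have := no h; rewrite hE eqxx.
have QN j i : Q j i = None -> mul (l j) (r i) \in B.
  by have := QP j i; case: (Q j i).
have eB : e \notin B by move: eJ; rewrite factorE => /andP[].
have [_ idB _ _] := AB.
exists H, #|I|, #|K|, Q, psi; split; split.
- move=> j; have [t tL lt] := R_right_inverse mulA AB eJ ee (lR j).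
  have [x [h [xI hH tE]]] := IT t tL.
  exists (enum_rank_in xI x) => /QN; rewrite /r enum_rankK_in // => inB.
  move: eB; rewrite -lt tE mulA.
  by have [_ ->] := @idB _ h inB.
- move=> i; have [t tR tr] := L_left_inverse mulA AB eJ ee (rL i).
  have [x [h [xK hH tE]]] := KT t tR.
  exists (enum_rank_in xK x) => /QN; rewrite /l enum_rankK_in // => inB.
  move: eB; rewrite -tr tE -mulA.
  by have [-> _] := @idB _ h inB.
(* Injectivity: [L_div_H] identifies the first index, its dual the second; cancelling [r i] and
   [l j] then identifies the group entry. *)
- move=> [[g i] j] [[h k] m]; rewrite /psi /= => E.
  have [c cH rE] := L_div_H mulA AB eJ ee (rL k) (rL i) (fH h) (fH g)
    (lR m) (lR j) (esym E).
  have ik : i = k by apply: enum_val_inj; apply: I1 (rI i) (rI k) cH rE.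
  rewrite -ik in E *; move: E => {c cH rE} E.
  have E' : op_mul mul (op_mul mul (l m) (f h)) (r i) =
            op_mul mul (op_mul mul (l j) (f g)) (r i).
    by rewrite /op_mul !mulA.
  have fH' x : f x \in H_set (op_mul mul) A B e by rewrite H_set_op.
  have [c cH lE] := L_div_H opA opAB eJ ee (lR m) (lR j) (fH' h) (fH' g)
    (rL i) (rL i) E'.
  rewrite H_set_op in cH; have jm : j = m.
    by apply: enum_val_inj; apply: K1 (lK j) (lK m) cH lE.
  rewrite -jm in E *; have [s _ sr] := L_left_inverse mulA AB eJ ee (rL i).
  have [t _ lt] := R_right_inverse mulA AB eJ ee (lR j).
  suff/f_inj -> : f g = f h by [].
  have cut x : mul (mul s (mul (mul (r i) (f x)) (l j))) t = f x.
    have /(H_setP AB eJ)[_ ex xe] := fH x.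
    by rewrite !mulA sr ex -mulA lt xe.
  by rewrite -cut E cut.
- move=> x; split=> [xJ|[[[h i] j] <-]]; last first.
    (* Multiplying by [s] and [t] recovers [f h], so the product is outside [B]. *)
    rewrite /psi /=; have [s _ sr] := L_left_inverse mulA AB eJ ee (rL i).
    have [t _ lt] := R_right_inverse mulA AB eJ ee (lR j).
    have /L_setP[hrJ _] := L_mul_H mulA AB eJ ee (rL i) (fH h).
    have := hrJ; rewrite !factorE => /andP[hrA _]; rewrite (ideal_mulr AB) //=.
    apply: (@factor_middle _ mul _ _ AB s _ t).
    have /(H_setP AB eJ)[_ eh he] := fH h.
    by rewrite !mulA sr eh -mulA lt he (H_J (fH h)).
  have [x1 [x2 [x1L x2R xE]]] := factor_LR mulA AB eJ ee xJ.
  have [a [h [aI hH aE]]] := IT x1 x1L; have [b [k [bK kH bE]]] := KT x2 x2R.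
  have /fP[g gE] := H_mul mulA AB eJ ee hH kH.
  exists (g, enum_rank_in aI a, enum_rank_in bK b).
  by rewrite /psi /= /r /l !enum_rankK_in // gE xE aE bE !mulA.
- move=> [[g i] j] [[h k] m] /=; have := QP j k.
  case: (Q j k) => [q qE|inB]; rewrite /psi /=.
    by rewrite !fM qE !mulA.
  set y := mul (mul _ (f g)) _; set z := mul (mul _ _) _.
  have -> : mul y z =
      mul (mul (r i) (f g)) (mul (mul (l j) (r k)) (mul (f h) (l m))).
    by rewrite /y /z !mulA.
  have [_ inB2] := @idB _ (mul (f h) (l m)) inB.
  by case: (@idB _ (mul (r i) (f g)) inB2).
Qed.

(** * The congruence generated by [eta] *)

Section EtaStar.

Variables (S : finType) (mul : S -> S -> S).
Hypothesis mulA : associative mul.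
Local Notation "x ** y" := (mul x y) (at level 40, left associativity).
Local Notation m1 := (mul1 mul).
Local Notation "x ~~> y" := (eta_star mul x y) (at level 70).

Lemma eta_star_congruence : congruence mul (eta_star mul).
Proof.
split.
- by move=> x C [Cr _ _ _] _; apply: Cr.
- by move=> x y xy C CC eC; have [_ Cs _ _] := CC; apply: Cs; apply: xy.
- move=> x y z xy yz C CC eC; have [_ _ Ct _] := CC.
  exact: Ct (xy C CC eC) (yz C CC eC).
- move=> x y c xy; split=> C CC eC; have [_ _ _ Cc] := CC.
    by have [] := Cc _ _ c (xy C CC eC).
  by have [] := Cc _ _ c (xy C CC eC).
Qed.

Lemma eta_star_trans y x z : x ~~> y -> y ~~> z -> x ~~> z.
Proof. by case: eta_star_congruence => _ _ t _; apply: t. Qed.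

Lemma eta_star_mul x x' y y' : x ~~> x' -> y ~~> y' -> x ** y ~~> x' ** y'.
Proof.
case: eta_star_congruence => _ _ _ c xx' yy'.
by apply: (eta_star_trans (y := x' ** y));
  [case: (c _ _ y xx') | case: (c _ _ x' yy')].
Qed.

Lemma eta_star_mul1 u v x x' y :
  x ~~> x' -> Some y = m1 (m1 u (Some x)) v ->
  exists2 y', Some y' = m1 (m1 u (Some x')) v & y ~~> y'.
Proof.
case: eta_star_congruence => r _ _ _ xx'.
case: u v => [u|] [v|] /= [->]; eexists; try by [].
- by apply: eta_star_mul => //; apply: eta_star_mul.
- exact: eta_star_mul.
- exact: eta_star_mul.
Qed.

(** The right-hand sides are [lambda_2] and [rho_2] at [z_1 = z_2 = c], so a single [eta_2] step
    relates [x] to [y]. *)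
Lemma eta2_eta_star x y c :
  x = x ** c ** y ** c ** (y ** c ** x) ->
  y = y ** c ** x ** c ** (x ** c ** y) -> x ~~> y.
Proof.
move=> xE yE C CC; apply; apply: t_step; exists 2 => //=.
exists [tuple Some c; Some c]; split; last 2 first.
- by rewrite /lambda_rho /= -xE.
- by rewrite /lambda_rho /= -yE.
- by case=> [[|[|]]].
Qed.

(** [e] and [f] form a right zero band, where a product equals its last factor; with [c = e], the
    words [lambda_2] and [rho_2] end in [e] and [f]. *)
Lemma eta_star_R_idempotents e f :
  e ** f = f -> f ** e = e -> e ~~> f.
Proof.
move=> ef fe.
have ee : e ** e = e by rewrite -{2}fe mulA ef fe.
have ff : f ** f = f by rewrite -{2}ef mulA fe ef.
by apply: (@eta2_eta_star _ _ e); rewrite ?(mulA, ee, ff, ef, fe).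
Qed.

(** Dually, a product equals its first factor, and the two words begin with [e] and [f]. *)
Lemma eta_star_L_idempotents e f :
  e ** f = e -> f ** e = f -> e ~~> f.
Proof.
move=> ef fe.
have ee : e ** e = e by rewrite -{1}ef -mulA fe ef.
have ff : f ** f = f by rewrite -{1}fe -mulA ef fe.
by apply: (@eta2_eta_star _ _ e); rewrite ?(mulA, ee, ff, ef, fe).
Qed.

(* With e, f, g the idempotents at the positions (t, r), (t, r'), (t', r), the
   product f g lies in B if Q r' t' is zero, while f g eta* e e = e. *)
Lemma rees_CS_diagonal (A B : {set S}) (H : finGroupType) (n m : nat)
    (Q : 'M[option H]_(m, n)) (psi : H * 'I_n * 'I_m -> S) :
  rees_identification Q mul A B psi ->
  (forall x y, x \in A :\: B -> y \in B -> ~ x ~~> y) ->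
  CS_diagonal Q.
Proof.
move=> [_ psiJ psiM] sep r r' t t' rt r't rt' r't'.
case E: (Q r t) rt => [a|] // _; case E1: (Q r' t) r't => [b|] // _.
case E2: (Q r t') rt' => [c|] // _.
(* Inverting the sandwich entry in the group coordinate makes each of the three elements
   idempotent. *)
pose e := psi (a^-1, t, r)%g; pose f := psi (b^-1, t, r')%g.
pose g := psi (c^-1, t', r)%g.
have ee : e ** e = e.
  by have := psiM (a^-1, t, r)%g (a^-1, t, r)%g; rewrite /= E mulVg mul1g.
have ef : e ** f = f.
  by have := psiM (a^-1, t, r)%g (b^-1, t, r')%g; rewrite /= E mulVg mul1g.
have fe : f ** e = e.
  by have := psiM (b^-1, t, r')%g (a^-1, t, r)%g; rewrite /= E1 mulVg mul1g.
have eg : e ** g = e.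
  by have := psiM (a^-1, t, r)%g (c^-1, t', r)%g; rewrite /= E2 mulgK.
have ge : g ** e = g.
  by have := psiM (c^-1, t', r)%g (a^-1, t, r)%g; rewrite /= E mulgK.
have fgB : f ** g \in B.
  by have := psiM (b^-1, t, r')%g (c^-1, t', r)%g; rewrite /= r't'.
have eJ : e \in A :\: B by apply/psiJ; exists (a^-1, t, r)%g.
apply: (sep e (f ** g) eJ fgB); rewrite -{1}ee.
by apply: eta_star_mul;
  [apply: eta_star_R_idempotents | apply: eta_star_L_idempotents].
Qed.

(** The class is that of [k]: the nonzero entry puts [k] in its own class and [j] among the
    associated rows. *)
Lemma rees_I_class (H : finGroupType) (n m : nat) (Q : 'M[option H]_(m, n))
    (j : 'I_m) (k : 'I_n) :
  Q j k <> None ->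
  exists r : 'I_(n_eta_star Q), k \in I_class r /\ j \in I'_class r.
Proof.
move=> /eqP Qjk; pose C := [set y in [set: 'I_n] | col_equiv Q k y].
have CI : C \in col_classes Q by apply: imset_f; rewrite inE.
have kC : k \in C.
  by rewrite !inE /col_equiv; apply/existsP; exists j; rewrite Qjk.
exists (enum_rank_in CI C); have IC : I_class (enum_rank_in CI C) = C.
  exact: enum_rankK_in.
split; first by rewrite IC.
by rewrite inE; apply/existsP; exists k; rewrite IC kC.
Qed.

(** * Terms of a principal series *)

Section Series.

Variables (o : nat) (Sr : nat -> {set S}).
Hypothesis hSr : principal_series mul o Sr.

Lemma series_factor p : 1 <= p <= o -> principal_factor mul (Sr p) (Sr p.+1).
Proof.
case: hSr => _ _ id pr po; have /andP[p1 lepo] := po; have [BA noC] := pr p po.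
by split=> //; apply: id; rewrite ?p1 ?ltnS // ltnW.
Qed.

(** Unless all products fall in [Sr p.+1], which makes the factor null, some [x], [y] and [x ** y]
    all lie in the factor. *)
Lemma non_null_factor_idempotent p :
  1 <= p <= o -> ~ null_factor mul (Sr p) (Sr p.+1) ->
  exists2 e, e \in Sr p :\: Sr p.+1 & e ** e = e.
Proof.
move=> po hnn; have AB := series_factor po.
case: (classic (exists x y,
  [/\ x \in Sr p, y \in Sr p & x ** y \notin Sr p.+1])).
  move=> [x [y [xA yA xyB]]].
  have xyJ : x ** y \in Sr p :\: Sr p.+1.
    by rewrite factorE xyB (ideal_mulr AB).
  by apply: (factor_idempotent mulA AB (x := x) (y := y)) => //;
    [apply: (factor_mulr AB (y := y)) | apply: (factor_mull AB (x := x))].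
move=> no; case: hnn.
have inB x y : x \in Sr p -> y \in Sr p -> x ** y \in Sr p.+1.
  by move=> xA yA; apply: contraT => xyB; case: no; exists x, y.
have [_ _ BA _] := AB; have [sBA [a aA _]] := properP BA.
exists (a ** a) => [|x y xA yA]; first exact: (ideal_mulr AB).
by right; rewrite !inB.
Qed.

(** Going down the series from [p], the search must stop, since [Sr o.+1] is empty. *)
Lemma last_related_ideal p a :
  p <= o -> a \in Sr p ->
  exists p', [/\ p <= p' <= o, exists2 y, y \in Sr p' & a ~~> y
    & forall y, y \in Sr p'.+1 -> ~ a ~~> y].
Proof.
move=> po aA; have [_ So _ _] := hSr.
pose P q := exists2 y, y \in Sr q & a ~~> y.
have Pp : P p by exists a => //; case: eta_star_congruence.
(* With truncated subtraction, the last equation says [q <= o.+1]. *)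
have : forall q, p <= q -> P q -> q + (o.+1 - q) = o.+1 ->
  exists p', [/\ p <= p' <= o, P p' & ~ P p'.+1].
  move=> q; move: {2}(o.+1 - q) (erefl (o.+1 - q)) => d.
  elim: d q => [|d IHd] q dE pq Pq qE.
    by case: Pq => y; rewrite (_ : q = o.+1) ?So ?inE // -qE dE addn0.
  have qo : q <= o by rewrite -ltnS -subn_gt0 dE.
  case: (classic (P q.+1)) => Pq1; last by exists q; rewrite pq qo.
  apply: (IHd q.+1) => //.
    by rewrite subSS; apply: succn_inj; rewrite -dE subSn.
    exact: leqW.
  by rewrite subnKC.
move=> /(_ p (leqnn p) Pp); rewrite subnKC ?leqW //.
move=> /(_ erefl) [p' [pp' Pp' nP]].
by exists p'; split=> // y yS ay; apply: nP; exists y.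
Qed.

End Series.

End EtaStar.

Theorem lemma3p1 (S : finType) (mul : S -> S -> S) (mulA : associative mul)
    (o : nat) (Sr : nat -> {set S}) (hSr : principal_series mul o Sr)
    (p : nat) (hp : 1 <= p <= o)
    (hnn : ~ null_factor mul (Sr p) (Sr p.+1))
    (ha : exists2 a, a \in Sr p :\: Sr p.+1 &
            forall t, is_zero mul t -> ~ eta_star mul a t) :
  exists2 p', p <= p' <= o &
  [/\ (* (1) *)
      forall x, x \in Sr p :\: Sr p.+1 ->
        exists2 y, y \in Sr p' :\: Sr p'.+1 & eta_star mul x y,
      (* (2) *)
      forall z z',
        z \in (Sr p :\: Sr p.+1) :|: (Sr p' :\: Sr p'.+1) ->
        z' \in Sr p'.+1 -> ~ eta_star mul z z',
      (* (3) *)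
      exists (H : finGroupType) (n' m' : nat) (Q : 'M[option H]_(m', n'))
             (psi : H * 'I_n' * 'I_m' -> S),
        [/\ rees_regular Q,
            rees_identification Q mul (Sr p') (Sr p'.+1) psi
          & CS_diagonal Q]
    & (* (4) *)
      forall (G : finGroupType) (n m : nat) (P : 'M[option G]_(m, n))
             (phi : G * 'I_n * 'I_m -> S)
             (H : finGroupType) (n' m' : nat) (Q : 'M[option H]_(m', n'))
             (psi : H * 'I_n' * 'I_m' -> S),
        rees_regular P ->
        rees_identification P mul (Sr p) (Sr p.+1) phi ->
        rees_regular Q ->
        rees_identification Q mul (Sr p') (Sr p'.+1) psi ->
        forall (g g' : G) (alpha gamma : 'I_n) (beta lambda : 'I_m)
               (h h' : H) (i k : 'I_n') (j l : 'I_m'),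
          P beta gamma <> None ->
          eta_star mul (phi (g, alpha, beta)) (psi (h, i, j)) ->
          eta_star mul (phi (g', gamma, lambda)) (psi (h', k, l)) ->
          exists r : 'I_(n_eta_star Q),
            k \in I_class r /\ j \in I'_class r].
Proof.
have AB := series_factor hSr hp; have [a aJ _] := ha.
have [_ po] := andP hp.
have aA : a \in Sr p by move: aJ; rewrite factorE => /andP[].
have [p' [pp' [b bA' ab] sepa]] := last_related_ideal hSr po aA.
have hp' : 1 <= p' <= o.
  have [lepp' ->] := andP pp'; have [p1 _] := andP hp.
  by rewrite (leq_trans p1 lepp').
have AB' := series_factor hSr hp'.
have [idA' idB' _ _] := AB'.
have bJ' : b \in Sr p' :\: Sr p'.+1.
  by rewrite factorE bA'; apply/negP => bB; apply: sepa bB ab.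
(* Since [c = u z v], relating [z] to [z'] would relate [c], hence [a], to [u z' v], which lies in
   the ideal [Sr p'.+1]. Used with [c = a] and with [c = b]. *)
have sepJ c (A B : {set S}) : principal_factor mul A B ->
    c \in A :\: B -> eta_star mul a c ->
    forall z z', z \in A :\: B -> z' \in Sr p'.+1 -> ~ eta_star mul z z'.
  move=> AB0 cJ ac z z' zJ z'B zz'.
  have [u [v cE]] := factor_divides mulA AB0 zJ cJ.
  have [c' c'E cc'] := eta_star_mul1 zz' cE.
  exact: sepa (ideal_mul1 idB' z'B c'E) (eta_star_trans ac cc').
have sep z z' : z \in (Sr p :\: Sr p.+1) :|: (Sr p' :\: Sr p'.+1) ->
    z' \in Sr p'.+1 -> ~ eta_star mul z z'.
  rewrite inE => /orP[zJ|zJ'].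
    by apply: (sepJ a) AB _ _ _ _ zJ => //; case: (eta_star_congruence mul).
  exact: (sepJ b) AB' _ _ _ _ zJ'.
have sepp z z' zJ := sep z z' (subsetP (subsetUl _ _) z zJ).
have sepp' z z' zJ := sep z z' (subsetP (subsetUr _ _) z zJ).
have down x : x \in Sr p :\: Sr p.+1 ->
    exists2 y, y \in Sr p' :\: Sr p'.+1 & eta_star mul x y.
  move=> xJ; have [u [v xE]] := factor_divides mulA AB aJ xJ.
  have [y yE xy] := eta_star_mul1 ab xE; exists y => //.
  rewrite factorE (ideal_mul1 idA' bA' yE) /=.
  by apply/negP => yB; apply: sepp xJ yB xy.
have [e eJ ee] := non_null_factor_idempotent mulA hSr hp hnn.
(* Squaring relates [e = e ** e] to [y ** y], so separation keeps this square out of [Sr p'.+1]. *)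
have [f fJ' ff] : exists2 f, f \in Sr p' :\: Sr p'.+1 & mul f f = f.
  have [y yJ' ey] := down e eJ; apply: (factor_idempotent mulA AB' yJ' yJ').
  have yA' : y \in Sr p' by move: yJ'; rewrite factorE => /andP[].
  rewrite factorE (ideal_mulr AB') //=; apply/negP => yyB.
  by apply: (sepp _ _ eJ yyB); rewrite -ee; apply: eta_star_mul.
exists p' => //; split=> //.
- have [H [n' [m' [Q [psi [regQ idQ]]]]]] := rees_theorem mulA AB' fJ' ff.
  exists H, n', m', Q, psi; split=> //.
  exact: rees_CS_diagonal idQ sepp'.
- move=> G n m P phi H n' m' Q psi _ [_ phiJ phiM] _ [_ psiJ psiM].
  move=> g g' alpha gamma beta lambda h h' i k j l Pbg e1 e2.
  (* It suffices that [Q j k] is nonzero; otherwise a product in the factor at [p] would be related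
     to one in [Sr p'.+1]. *)
  apply: rees_I_class => Qjk.
  have := phiM (g, alpha, beta) (g', gamma, lambda).
  case E: (P beta gamma) Pbg => [q|] // _; rewrite /= E => phiE.
  have := psiM (h, i, j) (h', k, l); rewrite /= Qjk => inB.
  apply: sepp inB (eta_star_mul e1 e2).
  by rewrite phiE; apply/phiJ; eexists.
Qed.
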